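(* Let $\mathfrak{g}$ be a finite dimensional $2$-step nilpotent Lie algebra over a field $k$ with $b_1(\mathfrak{g})=n$. Then $$\dim_k F_2\mathrm{H}^2(\mathfrak{g},k)=\binom{n}{2}+n-\dim_k\mathfrak{g},$$ $$\dim_k F_2\mathrm{H}^2(\mathfrak{g},\mathfrak{g})=\binom{n+1}{2}\dim_k Z(\mathfrak{g})-n\dim_k\mathfrak{g}-(\dim_k\mathfrak{g})(\dim_k Z(\mathfrak{g}))+\dim_k\mathrm{Der}(\mathfrak{g}),$$ where $Z(\mathfrak{g})$ is the center of $\mathfrak{g}$ and $\mathrm{Der}(\mathfrak{g})$ is the derivation algebra of $\mathfrak{g}$.
   Context: The field $k$ is arbitrary; $k$ as coefficients is the trivial $\mathfrak{g}$-module and $\mathfrak{g}$ as coefficients is the adjoint module. $b_1(\mathfrak{g})=\dim_k\mathrm{H}^1(\mathfrak{g},k)=\dim_k\mathfrak{g}/[\mathfrak{g},\mathfrak{g}]$. The lower central series is $\mathfrak{g}^1=\mathfrak{g}$, $\mathfrak{g}^{i+1}=[\mathfrak{g},\mathfrak{g}^i]$; $\mathfrak{g}$ is $p$-step nilpotent if $\mathfrak{g}^p\ne0$ and $\mathfrak{g}^{p+1}=0$. For a $\mathfrak{g}$-module $M$ set $M_j=0$ for integers $j\le0$ and $M_i=\{m\in M\mid xm\in M_{i-1}\text{ for all }x\in\mathfrak{g}\}$ for $i\ge1$. Let $F_r\mathrm{Hom}_k(\Lambda^2(\mathfrak{g}),M)$ be the set of $f\in\mathrm{Hom}_k(\Lambda^2(\mathfrak{g}),M)$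 such that $f(x\wedge y)\in M_{r-i-j+1}$ whenever $x\in\mathfrak{g}^i$, $y\in\mathfrak{g}^j$. Then $F_r\mathrm{H}^2(\mathfrak{g},M)\subset\mathrm{H}^2(\mathfrak{g},M)$ (Chevalley-Eilenberg cohomology) is the subspace of classes represented by $2$-cocycles lying in $F_r\mathrm{Hom}_k(\Lambda^2(\mathfrak{g}),M)$. *)

(* Defs.v *)
From HB Require Import structures.
From mathcomp Require Import all_boot all_algebra.
From mathcomp Require Import boolp.
Set Implicit Arguments.
Unset Strict Implicit.
Unset Printing Implicit Defensive.
Import GRing.Theory.
Local Open Scope ring_scope.

Section Span.
Variables (K : fieldType) (vT : vectType K).
Implicit Types (P : vT -> Prop) (U W : {vspace vT}).

Lemma vspan_subproof P : exists U : {vspace vT},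
  (forall v, P v -> v \in U) /\
  (forall W, (forall v, P v -> v \in W) -> (U <= W)%VS).
Proof.
pose Q d := `[< exists U, (forall v, P v -> v \in U) /\ \dim U = d >].
have exQ : exists d, Q d.
  by exists (\dim {:vT}); apply/asboolP; exists fullv; split=> // v _; rewrite memvf.
case: (ex_minnP exQ) => d /asboolP[U [PU dU]] minU; exists U; split=> // W PW.
have /minU : Q (\dim (U :&: W)).
  apply/asboolP; exists (U :&: W)%VS; split=> // v Pv.
  by rewrite memv_cap PU ?PW.
rewrite -dU => leUW; have /eqP <- : (U :&: W == U)%VS.
  by rewrite eqEdim capvSl leUW.
exact: capvSr.
Qed.

(* The linear span of a set of vectors. When P is stable under linear
   combinations this is the subspace {v | P v} itself (mem_vspanE); both uses
   occur below. *)
Definition vspan P : {vspace vT} := projT1 (cid (vspan_subproof P)).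

Lemma mem_vspan P v : P v -> v \in vspan P.
Proof. by rewrite /vspan; case: cid => U /= [PU _]; apply: PU. Qed.

Lemma vspan_min P W : (forall v, P v -> v \in W) -> (vspan P <= W)%VS.
Proof. by rewrite /vspan; case: cid => U /= [_]; apply. Qed.

Lemma mem_vspanE P :
  P 0 -> (forall a u v, P u -> P v -> P (a *: u + v)) ->
  forall v, v \in vspan P <-> P v.
Proof.
move=> P0 Plin v; split; last by move=> Pv; exact: mem_vspan.
pose Q d := `[< exists U, (forall v, v \in U -> P v) /\ \dim U = d >].
have exQ : exists d, Q d.
  exists 0; apply/asboolP; exists 0%VS; rewrite dimv0.
  by split=> // w; rewrite memv0 => /eqP->.
have ubQ d : Q d -> (d <= \dim {:vT})%N.
  by move=> /asboolP[U [_ <-]]; apply/dimvS/subvf.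
case: (ex_maxnP exQ ubQ) => d /asboolP[U [UP dU]] maxU.
suff PU : forall w, P w -> w \in U.
  by move=> vP; apply: UP; move: vP; apply/subvP/vspan_min.
move=> w Pw; have /maxU : Q (\dim (U + <[w]>)).
  apply/asboolP; exists (U + <[w]>)%VS; split=> // z.
  move=> /memv_addP[u /UP Pu [_ /vlineP[a ->] ->]].
  by rewrite addrC; apply: Plin.
rewrite -dU => le; have /eqP -> : (U == U + <[w]>)%VS.
  by rewrite eqEdim addvSl le.
by apply: (subvP (addvSr _ _)); rewrite memv_line.
Qed.

(* The quotient space vT / W, modelled on the chosen complement of W, with its
   canonical projection. *)
Definition vquot (W : {vspace vT}) := subvs_of (W^C)%VS.
HB.instance Definition _ W := Vector.on (vquot W).

Definition vquot_pi W : 'Hom(vT, vquot W) :=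
  (linfun (vsproj (W^C)%VS) \o daddv_pi (W^C)%VS W)%VF.

Lemma vquot_piE W v : vsval (vquot_pi W v) = daddv_pi (W^C)%VS W v.
Proof. by rewrite comp_lfunE lfunE /= vsprojK // memv_pi. Qed.

Lemma lker_vquot_pi W : lker (vquot_pi W) = W.
Proof.
have WC : (W^C :&: W = 0)%VS by rewrite capvC capv_compl.
apply/vspaceP => v; rewrite memv_ker -val_eqE /= vquot_piE.
have vS : v \in (W^C + W)%VS by rewrite addvC addv_complf memvf.
have dv := daddv_pi_add WC vS.
apply/eqP/idP=> [v0|vW]; first by rewrite -dv v0 add0r memv_pi.
apply/eqP; rewrite -memv0 -WC memv_cap memv_pi /=.
have -> : daddv_pi (W^C) W v = v - daddv_pi W (W^C) v by rewrite -{2}dv addrK.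
by rewrite rpredB ?memv_pi.
Qed.

Lemma limg_vquot_pi W : limg (vquot_pi W) = fullv.
Proof.
have WC : (W^C :&: W = 0)%VS by rewrite capvC capv_compl.
apply/vspaceP => w; rewrite memvf; apply/memv_imgP; exists (vsval w).
  exact: memvf.
by apply: val_inj; rewrite /= vquot_piE daddv_pi_id // subvsP.
Qed.

End Span.

HB.mixin Record isLieAlgebra (K : fieldType) (g : Type) of Vector K g := {
  lie : g -> g -> g;
  lie_linearl : forall y, linear (lie^~ y);
  lie_linearr : forall x, linear (lie x);
  liexx : forall x, lie x x = 0;
  lie_jacobi : forall x y z,
    lie x (lie y z) + lie y (lie z x) + lie z (lie x y) = 0
}.

(* Finite dimensional Lie algebras, since Vector is. *)
#[short(type="lieAlgType")]
HB.structure Definition LieAlgebra (K : fieldType) :=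
  {g of Vector K g & isLieAlgebra K g}.

Record lieModule (K : fieldType) (g : lieAlgType K) := LieModule {
  lmod_sort :> vectType K;
  lact : g -> lmod_sort -> lmod_sort;
  lact_linearl : forall m, linear (lact^~ m);
  lact_linearr : forall x, linear (lact x);
  lact_lie : forall x y m,
    lact (lie x y) m = lact x (lact y m) - lact y (lact x m)
}.
Arguments lact {K g l} x m.

Section LieAlgebraTheory.
Variables (K : fieldType) (g : lieAlgType K).
Implicit Types (x y z : g) (U V : {vspace g}).

Lemma lieD x y z : (lie (x + y) z = lie x z + lie y z)
  * (lie z (x + y) = lie z x + lie z y).
Proof.
by split; [have := lie_linearl z 1 x y | have := lie_linearr z 1 x y];
  rewrite /= !scale1r.
Qed.

Lemma lie0x x : lie 0 x = 0.
Proof. by have := (lieD 0 0 x).1; rewrite addr0 => /esym/(canRL (addrK _)); rewrite subrr. Qed.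

Lemma liex0 x : lie x 0 = 0.
Proof. by have := (lieD 0 0 x).2; rewrite addr0 => /esym/(canRL (addrK _)); rewrite subrr. Qed.

Lemma lieC x y : lie x y = - lie y x.
Proof.
have := liexx (x + y); rewrite !lieD !liexx add0r addr0 => /eqP.
by rewrite addr_eq0 => /eqP.
Qed.

Lemma lieNr x y : lie x (- y) = - lie x y.
Proof. by apply/eqP; rewrite -addr_eq0 -lieD addNr liex0. Qed.

Definition lie_prod U V : {vspace g} :=
  vspan (fun z => exists x y, [/\ x \in U, y \in V & z = lie x y]).

(* Indexed from 1: lcs 1 = g and lcs i.+1 = [g, lcs i] for 0 < i. The value at
   0 is irrelevant. *)
Definition lcs (i : nat) : {vspace g} := iter i.-1 (lie_prod fullv) fullv.

Definition nilpotent_of_step (p : nat) : Prop :=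
  lcs p <> 0%VS /\ lcs p.+1 = 0%VS.

Definition lie_center : {vspace g} := vspan (fun z => forall x, lie x z = 0).

Lemma mem_lie_center z : z \in lie_center <-> forall x, lie x z = 0.
Proof.
apply: mem_vspanE => [x|a u v u0 v0 x]; first exact: liex0.
by rewrite lie_linearr u0 v0 scaler0 addr0.
Qed.

Definition Der : {vspace 'End(g)} :=
  vspan (fun D : 'End(g) =>
    forall x y, D (lie x y) = lie (D x) y + lie x (D y)).

Lemma mem_Der (D : 'End(g)) :
  D \in Der <-> forall x y, D (lie x y) = lie (D x) y + lie x (D y).
Proof.
apply: (mem_vspanE (P := fun D : 'End(g) => _)) => [x y|a u v uD vD x y].
  by rewrite !lfunE /= lie0x liex0 addr0.
rewrite !add_lfunE !scale_lfunE uD vD lie_linearl lie_linearr.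
by rewrite scalerDr addrACA.
Qed.

Definition trivial_module : lieModule g.
Proof.
apply: (@LieModule K g K^o (fun _ _ => 0)).
- by move=> m a x y; rewrite scaler0 addr0.
- by move=> x a m n; rewrite scaler0 addr0.
- by move=> *; rewrite subrr.
Defined.

Definition adjoint_module : lieModule g.
Proof.
apply: (@LieModule K g g (@lie K g)).
- exact: lie_linearl.
- exact: lie_linearr.
- move=> x y m; have /eqP := lie_jacobi x y m.
  rewrite (lieC m (lie x y)) subr_eq0 => /eqP <-.
  by rewrite (lieC m x) lieNr.
Defined.

End LieAlgebraTheory.

Arguments lcs {K} g i.
Arguments nilpotent_of_step {K} g p.
Arguments lie_center {K} g.
Arguments Der {K} g.
Arguments trivial_module {K} g.
Arguments adjoint_module {K} g.

Section Cohomology.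
Variables (K : fieldType) (g : lieAlgType K) (M : lieModule g).
Implicit Types (x y z : g) (m : M) (h : 'Hom(g, M)) (f : 'Hom(g, 'Hom(g, M))).

Lemma lactr0 x : lact x 0 = 0 :> M.
Proof.
have := lact_linearr x 1 0 (0 : M); rewrite !scale1r addr0.
by move=> /esym/(canRL (addrK _)); rewrite subrr.
Qed.

(* Chevalley-Eilenberg differentials in degrees 0, 1 and 2. *)
Definition d0 m x : M := lact x m.
Definition d1 h x y : M := lact x (h y) - lact y (h x) - h (lie x y).
Definition d2 f x y z : M :=
  lact x (f y z) - lact y (f x z) + lact z (f x y)
  - f (lie x y) z + f (lie x z) y - f (lie y z) x.

Fact lincombD (a : K) (m m' n n' : M) :
  (a *: m + m') + (a *: n + n') = a *: (m + n) + (m' + n').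
Proof. by rewrite addrACA -scalerDr. Qed.

Fact lincombB (a : K) (m m' n n' : M) :
  (a *: m + m') - (a *: n + n') = a *: (m - n) + (m' - n').
Proof. by rewrite opprD addrACA -scalerBr. Qed.

Lemma d1_linear a h h' x y : d1 (a *: h + h') x y = a *: d1 h x y + d1 h' x y.
Proof. by rewrite /d1 !(add_lfunE, scale_lfunE) !lact_linearr !lincombB. Qed.

Lemma d2_linear a f f' x y z :
  d2 (a *: f + f') x y z = a *: d2 f x y z + d2 f' x y z.
Proof.
rewrite /d2 !(add_lfunE, scale_lfunE) !lact_linearr.
by rewrite !(lincombD, lincombB).
Qed.

Definition Z1 : {vspace 'Hom(g, M)} :=
  vspan (fun h => forall x y, d1 h x y = 0).
Definition B1 : {vspace 'Hom(g, M)} :=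
  vspan (fun h => exists m, forall x, h x = d0 m x).
Definition H1 : {vspace vquot B1} := (vquot_pi B1 @: Z1)%VS.

(* Hom_k(Lambda^2 g, M), as the alternating bilinear maps g -> g -> M. *)
Definition C2 : {vspace 'Hom(g, 'Hom(g, M))} :=
  vspan (fun f => forall x, f x x = 0).
Definition Z2 : {vspace 'Hom(g, 'Hom(g, M))} :=
  vspan (fun f => f \in C2 /\ forall x y z, d2 f x y z = 0).
Definition B2 : {vspace 'Hom(g, 'Hom(g, M))} :=
  vspan (fun f => exists h, forall x y, f x y = d1 h x y).
Definition H2 : {vspace vquot B2} := (vquot_pi B2 @: Z2)%VS.

Fixpoint mod_filt_nat (i : nat) : {vspace M} :=
  if i is i'.+1 then vspan (fun m => forall x, lact x m \in mod_filt_nat i')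
  else 0%VS.

Definition mod_filt (j : int) : {vspace M} :=
  if j is Posz i then mod_filt_nat i else 0%VS.

Definition FC2 (r : int) : {vspace 'Hom(g, 'Hom(g, M))} :=
  vspan (fun f => f \in C2 /\
    forall (i j : nat) x y, (0 < i)%N -> (0 < j)%N ->
      x \in lcs g i -> y \in lcs g j ->
      f x y \in mod_filt (r - i%:Z - j%:Z + 1)).

Definition FH2 (r : int) : {vspace vquot B2} :=
  (vquot_pi B2 @: (Z2 :&: FC2 r))%VS.

Lemma FH2_sub r : (FH2 r <= H2)%VS.
Proof. exact/limgS/capvSl. Qed.

Lemma mem_Z1 h : h \in Z1 <-> forall x y, d1 h x y = 0.
Proof.
apply: (mem_vspanE (P := fun h => _)) => [x y|a u v u0 v0 x y].
  by rewrite /d1 !zero_lfunE !lactr0 !subr0.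
by rewrite d1_linear u0 v0 scaler0 addr0.
Qed.

Lemma mem_B1 h : h \in B1 <-> exists m, forall x, h x = d0 m x.
Proof.
apply: (mem_vspanE (P := fun h => _)) => [|a u v [m um] [n vn]].
  by exists 0 => x; rewrite zero_lfunE /d0 lactr0.
exists (a *: m + n) => x.
by rewrite add_lfunE scale_lfunE um vn /d0 lact_linearr.
Qed.

Lemma mem_C2 f : f \in C2 <-> forall x, f x x = 0.
Proof.
apply: (mem_vspanE (P := fun f => _)) => [x|a u v u0 v0 x].
  by rewrite !zero_lfunE.
by rewrite !(add_lfunE, scale_lfunE) u0 v0 scaler0 addr0.
Qed.

Lemma mem_Z2 f : f \in Z2 <-> f \in C2 /\ forall x y z, d2 f x y z = 0.
Proof.
apply: (mem_vspanE (P := fun f => _)) => [|a u v [uC u0] [vC v0]].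
  split=> [|x y z]; first exact: mem0v.
  have := d2_linear (-1) 0 0 x y z; rewrite scaler0 addr0 => ->.
  by rewrite scaleN1r addNr.
split=> [|x y z]; first by rewrite memvD ?memvZ.
by rewrite d2_linear u0 v0 scaler0 addr0.
Qed.

Lemma mem_B2 f : f \in B2 <-> exists h, forall x y, f x y = d1 h x y.
Proof.
apply: (mem_vspanE (P := fun f => _)) => [|a u v [h uh] [h' vh']].
  exists 0 => x y; have := d1_linear (-1) 0 0 x y; rewrite scaler0 addr0 => ->.
  by rewrite scaleN1r addNr !zero_lfunE.
exists (a *: h + h') => x y.
by rewrite d1_linear !(add_lfunE, scale_lfunE) uh vh'.
Qed.

Lemma mem_mod_filt_natS i m :
  m \in mod_filt_nat i.+1 <-> forall x, lact x m \in mod_filt_nat i.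
Proof.
apply: mem_vspanE => [x|a u v u0 v0 x]; first by rewrite lactr0 mem0v.
by rewrite lact_linearr memvD ?memvZ.
Qed.

Lemma mem_FC2 (r : int) f : f \in FC2 r <-> f \in C2 /\
  forall (i j : nat) x y, (0 < i)%N -> (0 < j)%N ->
    x \in lcs g i -> y \in lcs g j ->
    f x y \in mod_filt (r - i%:Z - j%:Z + 1).
Proof.
apply: (mem_vspanE (P := fun f => _)) => [|a u v [uC uF] [vC vF]].
  by split=> [|i j x y *]; rewrite ?mem0v // !zero_lfunE mem0v.
split=> [|i j x y *]; first by rewrite memvD ?memvZ.
by rewrite !(add_lfunE, scale_lfunE) memvD ?memvZ ?uF ?vF.
Qed.

End Cohomology.

Arguments H1 {K g} M.
Arguments H2 {K g} M.
Arguments FH2 {K g} M r.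

Definition b1 (K : fieldType) (g : lieAlgType K) : nat :=
  \dim (H1 (trivial_module g)).

(* Main.v *)
From HB Require Import structures.
Require Import Defs.
From mathcomp Require Import all_boot all_algebra.
From mathcomp Require Import zify.
Set Implicit Arguments.
Unset Strict Implicit.
Unset Printing Implicit Defensive.
Import GRing.Theory.
Local Open Scope ring_scope.

(** Write D for the derived algebra [g, g], which is central because g is
    2-step nilpotent, and M^g for the invariants M_1 of a g-module M.

    The condition defining F_2 asks f (x, y) to lie in M^g for all x and y and
    in M_0 = 0 as soon as x or y lies in D. So F_2 Hom(Lambda^2 g, M) consists
    of the alternating maps on g / D with values in M^g, and since
    dim (g / D) = b1 g = n, it has dimension 'C(n, 2) * dim M^g
    ([dim_alternating_vanishing], [mem_FC2_2]). All terms of the differential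
    of such a map vanish, so each of them is a cocycle ([FC2_2_sub_Z2]), and
    F_2 H^2 is the quotient by the coboundaries it contains. Let P be the space
    of the 1-cochains with coboundary in F_2. Its image under the differential
    has dimension dim P - dim Z^1, hence ([dim_FH2_2])

      dim F_2 H^2 = 'C(n, 2) * dim M^g - dim P + dim Z^1.

    For M = k every coboundary is, up to sign, (x, y) |-> h [x, y], which
    vanishes when x is in D, so P is the whole dual of g; and Z^1 is the dual of
    g / D, of dimension n.

    For M = g the invariants are the center Z and Z^1 is Der g. For x in D the
    coboundary of h at (x, y) is -[y, h x], so P consists of the h mapping D
    into Z ([coboundary_adjoint_FC2]). Its dimension is
    dim D * dim Z + n * dim g ([dim_lfun_mapping_into]), and the stated formula
    follows from dim D = dim g - n and 'C(n, 2) + n = 'C(n.+1, 2). *)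

(** * Spaces of linear and alternating maps *)

Section LinearMaps.
Variables (K : fieldType).
Implicit Types (U V M : vectType K).

(** Lets a linear map be built from a function and a proof, without declaring
    a structure instance for the function. *)
Lemma linfun_linearE U V (F : U -> V) : linear F -> linfun F =1 F.
Proof.
move=> Flin.
pose L := GRing.isLinear.Build K U V *:%R F Flin.
pose G : {linear U -> V} := HB.pack F L.
exact: (lfunE G).
Qed.

(** Such maps are the homomorphisms from U / Y to W. *)
Lemma dim_lfun_vanishing U M (Y : {vspace U}) (W : {vspace M})
    (A : {vspace 'Hom(U, M)}) :
  (forall h, h \in A <->
     (forall x, x \in Y -> h x = 0) /\ (forall x, h x \in W)) ->
  \dim A = ((\dim {:U} - \dim Y) * \dim W)%N.
Proof.
move=> memA.
pose F (h : 'Hom(vquot Y, subvs_of W)) : 'Hom(U, M) :=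
  (linfun vsval \o h \o vquot_pi Y)%VF.
have FE h x : F h x = vsval (h (vquot_pi Y x)) by rewrite !comp_lfunE lfunE.
have Flin : linear F.
  by move=> a h h'; apply/lfunP => x; rewrite !(add_lfunE, scale_lfunE, FE).
have -> : A = limg (linfun F).
  apply/vspaceP => f; apply/idP/memv_imgP => [/memA[f0 fW] | [h _ ->]].
    exists (linfun (vsproj W) \o f \o linfun vsval)%VF; first exact: memvf.
    apply/lfunP => x; rewrite linfun_linearE // FE !comp_lfunE !lfunE /=.
    have xS : x \in (Y^C + Y)%VS by rewrite addvC addv_complf memvf.
    have YC : (Y^C :&: Y = 0)%VS by rewrite capvC capv_compl.
    rewrite !vsprojK ?memv_pi // -{1}(daddv_pi_add YC xS).
    by rewrite linearD /= [X in _ + X]f0 ?memv_pi // addr0.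
  rewrite linfun_linearE //; apply/memA; split=> [x xY|x].
    rewrite FE; move: xY; rewrite -{1}(lker_vquot_pi Y) memv_ker => /eqP->.
    by rewrite linear0.
  by rewrite FE subvsP.
rewrite limg_dim_eq.
  rewrite dimvf /= -dimv_compl; congr (_ * _)%N.
apply/eqP; rewrite capfv; apply/lker0P => h h'.
rewrite !linfun_linearE // => /lfunP ehh'; apply/lfunP => w.
have := memvf w; rewrite -limg_vquot_pi => /memv_imgP[x _ ->].
by apply: subvs_inj; rewrite -!FE.
Qed.

(** Restriction to D is onto the maps from D to Z, and its kernel consists of
    the maps vanishing on D. To stay among the maps defined on U, restriction is
    taken to be precomposition with the projection p onto D along D^C, so that
    its image consists of maps vanishing on D^C. *)
Lemma dim_lfun_mapping_into U M (D : {vspace U}) (Z : {vspace M})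
    (A : {vspace 'Hom(U, M)}) :
  (forall h, h \in A <-> forall x, x \in D -> h x \in Z) ->
  \dim A = (\dim D * \dim Z + (\dim {:U} - \dim D) * \dim {:M})%N.
Proof.
move=> memA; have DC := capv_compl D.
pose p := daddv_pi D D^C.
pose R (h : 'Hom(U, M)) : 'Hom(U, M) := (h \o p)%VF.
have Rlin : linear R.
  by move=> a h h'; rewrite /R comp_lfunDl -comp_lfunZl.
have RE h x : linfun R h x = h (p x) by rewrite linfun_linearE // comp_lfunE.
have pD x : x \in D -> p x = x by move=> xD; apply: daddv_pi_id.
have pDC x : x \in (D^C)%VS -> p x = 0.
  move=> xC; have xS : x \in (D + D^C)%VS by rewrite addv_complf memvf.
  have CD : (D^C :&: D = 0)%VS by rewrite capvC.
  have := daddv_pi_add DC xS; rewrite (daddv_pi_id CD xC) -/p.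
  by rewrite -[RHS]add0r => /addIr.
rewrite -(limg_ker_dim (linfun R) A) addnC; congr (_ + _)%N.
  rewrite (@dim_lfun_vanishing _ _ D^C Z) => [|f].
    by rewrite dimv_compl subKn // dimvS // subvf.
  split=> [/memv_imgP[h /memA hA ->] | [f0 fZ]].
    split=> x => [xC|]; first by rewrite RE pDC // linear0.
    by rewrite RE hA // memv_pi.
  apply/memv_imgP; exists f; first by apply/memA => x _.
  apply/lfunP => x; rewrite RE.
  have xS : x \in (D + D^C)%VS by rewrite addv_complf memvf.
  rewrite -{1}(daddv_pi_add DC xS) linearD /= [X in _ + X]f0 ?memv_pi //.
  by rewrite addr0.
apply: dim_lfun_vanishing => h; rewrite memv_cap memv_ker; split.
  move=> /andP[_ /eqP h0]; split=> x; last exact: memvf.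
  by move=> xD; rewrite -(pD _ xD) -RE h0 zero_lfunE.
move=> [h0 _]; apply/andP; split.
  by apply/memA => x xD; rewrite h0 ?mem0v.
by apply/eqP/lfunP => x; rewrite RE zero_lfunE h0 // memv_pi.
Qed.

(** Some coordinate of the class of v in U / D is nonzero; the form is this
    coordinate, rescaled. *)
Lemma separating_form U (D : {vspace U}) (v : U) : v \notin D ->
  exists l : 'Hom(U, K^o), l v = 1 /\ forall x, x \in D -> l x = 0.
Proof.
rewrite -{1}(lker_vquot_pi D) memv_ker => vD.
pose c j (x : U) := coord (vbasis fullv) j (vquot_pi D x).
have [j vj] : exists j, c j v != 0.
  apply/existsP; move: vD; apply: contraR; rewrite negb_exists => /forallP v0.
  apply/eqP; rewrite [LHS](coord_vbasis (memvf _)) big1 // => j _.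
  by have := v0 j; rewrite negbK => /eqP; rewrite /c => ->; rewrite scale0r.
pose L (x : U) : K^o := (c j v)^-1 * c j x.
have Llin : linear L.
  by move=> a x y; rewrite /L /c !linearP /= mulrDr mulrCA.
exists (linfun L); rewrite linfun_linearE //; split; first exact: mulVf.
move=> x; rewrite -{1}(lker_vquot_pi D) memv_ker => /eqP x0.
by rewrite linfun_linearE // /L /c [vquot_pi D x]x0 linear0 mulr0.
Qed.

(** Induction on the codimension of D, the case of codimension n.+1 resting on
    'C(n.+1, 2) = 'C(n, 2) + n: for v outside D, evaluation at v in the first
    argument maps these forms onto the linear maps from U / (D + <[v]>) to W,
    and its kernel consists of the forms that also vanish on v. *)
Lemma dim_alternating_vanishing U M (D : {vspace U}) (W : {vspace M})
    (A : {vspace 'Hom(U, 'Hom(U, M))}) :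
  (forall f, f \in A <-> [/\ forall x, f x x = 0,
     forall x y, x \in D -> f x y = 0 & forall x y, f x y \in W]) ->
  \dim A = ('C(\dim {:U} - \dim D, 2) * \dim W)%N.
Proof.
have [n] := ubnP (\dim {:U} - \dim D).
elim: n D A => // n IHn D A ltDn memA.
have [DU|/subvPn[v _ vD]] := boolP (fullv <= D)%VS.
  have -> : A = 0%VS.
    apply/vspaceP => f; rewrite memv0; apply/idP/eqP => [/memA[_ f0 _]|->].
      apply/lfunP => x; apply/lfunP => y; rewrite !zero_lfunE f0 //.
      exact/(subvP DU)/memvf.
    exact: mem0v.
  by rewrite dimv0 (eqP (dimvS DU)).
pose D' := (D + <[v]>)%VS.
have DD' : (D <= D')%VS by apply: addvSl.
have vD' : v \in D' by rewrite (subvP (addvSr _ _)) ?memv_line.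
have dimD' : \dim D' = (\dim D).+1.
  apply/eqP; rewrite eqn_leq; apply/andP; split.
    rewrite -addn1 (leq_trans (dimv_add_leqif _ _)) // leq_add2l dim_vline.
    exact: leq_b1.
  rewrite (ltn_leqif (dimv_leqif_sup DD')); apply: contra vD => /subvP.
  exact.
have ltDU : (\dim D < \dim {:U})%N by rewrite -dimD' dimvS ?subvf.
pose E (f : 'Hom(U, 'Hom(U, M))) := f v.
have Elin : linear E by move=> a f f'; rewrite /E add_lfunE scale_lfunE.
rewrite -(limg_ker_dim (linfun E) A).
have -> : \dim (A :&: lker (linfun E))
    = ('C(\dim {:U} - \dim D', 2) * \dim W)%N.
  apply: IHn => [|f]; first by rewrite dimD'; lia.
  rewrite memv_cap memv_ker linfun_linearE //; split.
    move=> /andP[/memA[fxx fD fW] /eqP fv]; split=> // x y.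
    move=> /memv_addP[d dD [_ /vlineP[a ->] ->]].
    rewrite linearD linearZ /= add_lfunE scale_lfunE -/(E f) fv fD //.
    by rewrite zero_lfunE scaler0 addr0.
  move=> [fxx fD fW]; apply/andP; split.
    by apply/memA; split=> // x y xD; rewrite fD // (subvP DD').
  by apply/eqP/lfunP => y; rewrite zero_lfunE -(fD v y).
have -> : \dim (linfun E @: A) = ((\dim {:U} - \dim D') * \dim W)%N.
  apply: dim_lfun_vanishing => h; split.
    move=> /memv_imgP[f /memA[fxx fD fW] ->]; rewrite linfun_linearE //.
    split=> [_ /memv_addP[d dD [_ /vlineP[a ->] ->]]|x]; last exact: fW.
    (* The vanishing at d in D is f v d = - f d v = 0. *)
    rewrite linearD linearZ /= {2}/E fxx scaler0 addr0 /E.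
    have := fxx (v + d); rewrite !linearD /= !add_lfunE !fxx.
    by rewrite (fD d v) // addr0 !add0r addr0.
  move=> [h0 hW]; have [l [lv lD]] := separating_form vD.
  (* The preimage is the wedge of the form l and h. *)
  pose H x y := l x *: h y - l y *: h x.
  have Hr x : linear (H x).
    move=> a y z; rewrite /H (linearP h) (linearP l).
    rewrite scalerDr !scalerDl !scalerA.
    by rewrite scalerBr !scalerA [a * l x]mulrC opprD addrACA.
  have Hl : linear (fun x => linfun (H x) : 'Hom(U, M)).
    move=> a x y; apply/lfunP => z.
    rewrite !(add_lfunE, scale_lfunE) !linfun_linearE // /H.
    rewrite (linearP h) (linearP l).
    rewrite scalerDr !scalerDl scalerBr !scalerA [a * l z]mulrC.
    by rewrite opprD addrACA.
  pose f : 'Hom(U, 'Hom(U, M)) := linfun (fun x => linfun (H x)).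
  have fE x y : f x y = H x y by rewrite /f !linfun_linearE.
  apply/memv_imgP; exists f.
    apply/memA; split=> [x|x y xD|x y]; rewrite fE /H ?subrr //.
      by rewrite lD // (h0 x) ?(subvP DD') // scale0r scaler0 subrr.
    by rewrite rpredB ?memvZ.
  rewrite linfun_linearE //; apply/lfunP => y; rewrite /E fE /H.
  by rewrite lv (h0 v) // scale1r scaler0 subr0.
rewrite -mulnDl dimD'; congr (_ * _)%N.
have -> : (\dim {:U} - \dim D = (\dim {:U} - (\dim D).+1).+1)%N by lia.
by rewrite binS bin1.
Qed.

End LinearMaps.

(** * The second step of the filtration on cohomology *)

Section Bracket.
Variables (K : fieldType) (g : lieAlgType K).

Lemma mem_lcs2 (x y : g) : lie x y \in lcs g 2.
Proof. by apply: mem_vspan; exists x, y; split; rewrite ?memvf. Qed.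

Lemma lcs_sub_lcs2 i : (1 < i)%N -> (lcs g i <= lcs g 2)%VS.
Proof.
case: i => [|[|i]] // _; apply: vspan_min => _ [x [y [_ _ ->]]].
exact: mem_lcs2.
Qed.

Lemma lfun_lcs2_into (V : vectType K) (W : {vspace V}) (h : 'Hom(g, V)) :
  (forall x, x \in lcs g 2 -> h x \in W) <-> (forall x y, h (lie x y) \in W).
Proof.
split=> [hW x y | hW x]; first exact/hW/mem_lcs2.
rewrite memv_preim; apply/subvP/vspan_min => _ [y [z [_ _ ->]]].
by rewrite -memv_preim.
Qed.

Lemma lie_lcs2 : nilpotent_of_step g 2 ->
  forall x y : g, y \in lcs g 2 -> lie x y = 0.
Proof.
move=> [_ g3] x y yD; apply/eqP; rewrite -memv0 -g3.
by apply: mem_vspan; exists x, y; split; rewrite ?memvf.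
Qed.

Lemma lcs2_lie : nilpotent_of_step g 2 ->
  forall x y : g, x \in lcs g 2 -> lie x y = 0.
Proof. by move=> g_nil x y xD; rewrite lieC lie_lcs2 ?oppr0. Qed.

End Bracket.

Section Filtration.
Variables (K : fieldType) (g : lieAlgType K) (M : lieModule g).

Lemma mem_invariants (m : M) :
  m \in mod_filt_nat M 1 <-> forall x, lact x m = 0.
Proof.
rewrite mem_mod_filt_natS.
by split=> m0 x; have := m0 x; rewrite memv0 => /eqP.
Qed.

(** As 2 - i - j + 1 is 1 for i = j = 1 and nonpositive otherwise, the
    filtration condition only distinguishes g from [g, g]. *)
Lemma mem_FC2_2 (f : 'Hom(g, 'Hom(g, M))) : f \in FC2 M 2 <->
  [/\ forall x, f x x = 0, forall x y, x \in lcs g 2 -> f x y = 0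
    & forall x y, f x y \in mod_filt_nat M 1].
Proof.
rewrite mem_FC2; split=> [[/mem_C2 fxx fF] | [fxx fD fW]].
  split=> // [x y xD|x y].
    have := fF 2%N 1%N x y isT isT xD (memvf y).
    by rewrite memv0 => /eqP.
  exact: (fF 1%N 1%N x y isT isT (memvf x) (memvf y)).
have fC x y : f x y = - f y x.
  have := fxx (x + y); rewrite !linearD /= !add_lfunE !fxx add0r addr0.
  by move=> /eqP; rewrite addrC addr_eq0 => /eqP.
split; first exact/mem_C2.
move=> i j x y i0 j0 xi yj.
have [i2|i1] := ltnP 1 i.
  by rewrite fD ?mem0v // (subvP (lcs_sub_lcs2 _ i2)).
have [j2|j1] := ltnP 1 j.
  by rewrite fC fD ?oppr0 ?mem0v // (subvP (lcs_sub_lcs2 _ j2)).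
have -> : i = 1%N by lia.
have -> : j = 1%N by lia.
exact: fW.
Qed.

(** Each term of d2 f either acts on an invariant or evaluates f at a
    bracket. *)
Lemma FC2_2_sub_Z2 : (FC2 M 2 <= Z2 M)%VS.
Proof.
apply/subvP => f /mem_FC2_2[fxx fD fW]; apply/mem_Z2; split; first exact/mem_C2.
have f0 x y z : lact x (f y z) = 0 by apply: (mem_invariants _).1 => //.
by move=> x y z; rewrite /d2 !f0 !fD ?mem_lcs2 // !(subr0, addr0).
Qed.

Definition coboundary : 'Hom('Hom(g, M), 'Hom(g, 'Hom(g, M))) :=
  linfun (fun h => linfun (fun x => linfun (d1 h x))).

Lemma coboundaryE h x y : coboundary h x y = d1 h x y.
Proof.
have lr (h' : 'Hom(g, M)) x' : linear (d1 h' x').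
  move=> a y' z; rewrite /d1 lie_linearr !(linearP h') lact_linearr.
  by rewrite (lact_linearl (h' x')) !lincombB.
have ll (h' : 'Hom(g, M)) : linear (fun x' => linfun (d1 h' x') : 'Hom(g, M)).
  move=> a x' z; apply/lfunP => y'.
  rewrite add_lfunE scale_lfunE !linfun_linearE // /d1 lie_linearl.
  by rewrite !(linearP h') lact_linearr (lact_linearl (h' y')) !lincombB.
rewrite /coboundary !linfun_linearE // => a h1 h2.
apply/lfunP => x'; apply/lfunP => y'.
by rewrite !(add_lfunE, scale_lfunE) !linfun_linearE // d1_linear.
Qed.

Lemma limg_coboundary : limg coboundary = B2 M.
Proof.
apply/vspaceP => f; apply/memv_imgP/idP => [[h _ ->] | /mem_B2[h fh]].
  by apply/mem_B2; exists h => x y; rewrite coboundaryE.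
exists h; first exact: memvf.
by apply/lfunP => x; apply/lfunP => y; rewrite fh coboundaryE.
Qed.

Lemma lker_coboundary : lker coboundary = Z1 M.
Proof.
apply/vspaceP => h; rewrite memv_ker; apply/eqP/idP => [h0 | /mem_Z1 h0].
  by apply/mem_Z1 => x y; rewrite -coboundaryE h0 !zero_lfunE.
by apply/lfunP => x; apply/lfunP => y; rewrite coboundaryE h0 !zero_lfunE.
Qed.

(** Rank-nullity twice: FH2 M 2 is FC2 M 2 modulo the coboundaries lying in
    it, and these are the image of [coboundary @^-1: FC2 M 2], with kernel
    Z1. *)
Lemma dim_FH2_2 :
  (\dim (FH2 M 2) + \dim (coboundary @^-1: FC2 M 2)
   = 'C(\dim {:g} - \dim (lcs g 2), 2) * \dim (mod_filt_nat M 1)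
     + \dim (Z1 M))%N.
Proof.
rewrite -(dim_alternating_vanishing mem_FC2_2).
rewrite /FH2 (capv_idPr FC2_2_sub_Z2).
rewrite -(limg_ker_dim (vquot_pi (B2 M)) (FC2 M 2)) lker_vquot_pi.
rewrite -(limg_ker_dim coboundary (coboundary @^-1: FC2 M 2)%VS).
rewrite -(lpreim_cap_limg _ (FC2 M 2)) lpreimK ?capvSr // limg_coboundary.
rewrite (capv_idPr _) ?lker_coboundary; last first.
  by rewrite -lker_coboundary -lpreim0; exact/lpreimS/sub0v.
by rewrite [RHS]addnC addnCA (addnC (\dim (vquot_pi _ @: _))).
Qed.

End Filtration.

(** * Trivial and adjoint coefficients *)

Lemma Z1_adjoint (K : fieldType) (g : lieAlgType K) :
  Z1 (adjoint_module g) = Der g.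
Proof.
apply/vspaceP => h; apply/idP/idP => [/mem_Z1 h0|/mem_Der hD].
  apply/mem_Der => x y; have /eqP := h0 x y.
  by rewrite /d1 /= (lieC y) opprK subr_eq0 addrC => /eqP ->.
apply/mem_Z1 => x y; rewrite /d1 /= hD (lieC y) opprK.
by rewrite [X in X - _]addrC subrr.
Qed.

Lemma invariants_adjoint (K : fieldType) (g : lieAlgType K) :
  mod_filt_nat (adjoint_module g) 1 = lie_center g.
Proof.
apply/vspaceP => z; apply/idP/idP => [/mem_invariants z0|/mem_lie_center z0].
  exact/mem_lie_center.
exact/mem_invariants.
Qed.

Lemma dim_trivial_module (K : fieldType) (g : lieAlgType K) :
  \dim {:trivial_module g} = 1%N.
Proof. by rewrite dimvf. Qed.

(** With trivial coefficients the cocycles are the linear forms on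
    g / [g, g]. *)
Lemma dim_Z1_trivial (K : fieldType) (g : lieAlgType K) :
  \dim (Z1 (trivial_module g)) = (\dim {:g} - \dim (lcs g 2))%N.
Proof.
rewrite (@dim_lfun_vanishing _ _ _ (lcs g 2) fullv) => [|h].
  by rewrite dim_trivial_module muln1.
rewrite mem_Z1; split=> [h0|[h0 _] x y].
  split=> x; last by rewrite memvf.
  move=> xD; apply/eqP; rewrite -memv0; move: x xD.
  apply/lfun_lcs2_into => x y; have := h0 x y.
  by rewrite /d1 /= subrr sub0r => /eqP; rewrite oppr_eq0 memv0.
by rewrite /d1 /= subr0 h0 ?mem_lcs2 // subr0.
Qed.

(** B1 is zero for trivial coefficients, so H1 has the dimension of Z1. *)
Lemma b1_dim_lcs2 (K : fieldType) (g : lieAlgType K) :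
  b1 g = (\dim {:g} - \dim (lcs g 2))%N.
Proof.
rewrite -dim_Z1_trivial /b1 /H1 limg_dim_eq // lker_vquot_pi.
apply/eqP; rewrite -subv0; apply/subvP => h; rewrite memv_cap.
move=> /andP[_ /mem_B1[m hm]]; rewrite memv0; apply/eqP/lfunP => x.
by rewrite hm zero_lfunE.
Qed.

(** Up to sign a coboundary is (x, y) |-> h [x, y], which vanishes for x in
    [g, g], so every coboundary has filtration 2. *)
Lemma dim_FH2_trivial (K : fieldType) (g : lieAlgType K) :
  nilpotent_of_step g 2 ->
  (\dim (FH2 (trivial_module g) 2) + \dim {:g} = 'C(b1 g, 2) + b1 g)%N.
Proof.
move=> g_nil; have := dim_FH2_2 (trivial_module g).
rewrite dim_Z1_trivial -b1_dim_lcs2.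
have M1 : mod_filt_nat (trivial_module g) 1 = fullv.
  by apply/vspaceP => m; rewrite memvf; apply/mem_invariants.
have -> : (coboundary (trivial_module g) @^-1: FC2 (trivial_module g) 2)%VS
    = fullv.
  apply/vspaceP => h; rewrite memvf -memv_preim; apply/mem_FC2_2.
  split=> [x|x y xD|x y]; rewrite ?coboundaryE /d1.
  - by rewrite /= liexx (linear0 h) !subr0.
  - by rewrite /= (lcs2_lie g_nil) // (linear0 h) !subr0.
  - by rewrite M1 memvf.
have -> : \dim {:'Hom(g, trivial_module g)} = \dim {:g}.
  by rewrite !dimvf; exact: muln1.
by rewrite M1 dim_trivial_module muln1.
Qed.

(** For x in [g, g] the coboundary of h at (x, y) reduces to -[y, h x]. When h
    maps [g, g] into the center, all values of the coboundary are central: they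
    are sums of brackets and of a value of h on [g, g]. *)
Lemma coboundary_adjoint_FC2 (K : fieldType) (g : lieAlgType K)
    (h : 'Hom(g, adjoint_module g)) : nilpotent_of_step g 2 ->
  (coboundary (adjoint_module g) h \in FC2 (adjoint_module g) 2
   <-> forall x, x \in lcs g 2 -> h x \in lie_center g).
Proof.
move=> g_nil; have D0 := lie_lcs2 g_nil; have D0l := lcs2_lie g_nil.
rewrite mem_FC2_2; split=> [[_ hD _] x xD | hZ].
  apply/mem_lie_center => y; have := hD x y xD.
  rewrite coboundaryE /d1 /= (D0l _ _ xD) (D0l x y xD) (linear0 h) sub0r subr0.
  by move=> /eqP; rewrite oppr_eq0 => /eqP.
split=> [x|x y xD|x y]; rewrite coboundaryE /d1.
- by rewrite /= liexx (linear0 h) !subrr.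
- rewrite /= (D0l _ _ xD) (D0l x y xD) (linear0 h).
  by rewrite (mem_lie_center _).1 ?hZ // !subr0.
- rewrite invariants_adjoint !rpredB //; last exact/hZ/mem_lcs2.
    by apply/mem_lie_center => z; rewrite D0 ?mem_lcs2.
  by apply/mem_lie_center => z; rewrite D0 ?mem_lcs2.
Qed.

Lemma dim_FH2_adjoint (K : fieldType) (g : lieAlgType K) :
  nilpotent_of_step g 2 ->
  (\dim (FH2 (adjoint_module g) 2)
     + (\dim (lcs g 2) * \dim (lie_center g) + b1 g * \dim {:g})
   = 'C(b1 g, 2) * \dim (lie_center g) + \dim (Der g))%N.
Proof.
move=> g_nil; have := dim_FH2_2 (adjoint_module g).
rewrite Z1_adjoint invariants_adjoint b1_dim_lcs2 => <-; congr addn.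
apply/esym/dim_lfun_mapping_into => h; rewrite -memv_preim.
exact: coboundary_adjoint_FC2.
Qed.

Theorem corollary1p6 (k : fieldType) (g : lieAlgType k) (n : nat)
    (g_nil : nilpotent_of_step g 2) (b1_g : b1 g = n) :
  (\dim (FH2 (trivial_module g) 2))%:Z
    = 'C(n, 2)%:Z + n%:Z - (\dim {:g})%:Z
  /\
  (\dim (FH2 (adjoint_module g) 2))%:Z
    = 'C(n.+1, 2)%:Z * (\dim (lie_center g))%:Z
      - n%:Z * (\dim {:g})%:Z
      - (\dim {:g})%:Z * (\dim (lie_center g))%:Z
      + (\dim (Der g))%:Z.
Proof.
have tdim := dim_FH2_trivial g_nil; have adim := dim_FH2_adjoint g_nil.
have dimD : (\dim {:g} = n + \dim (lcs g 2))%N.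
  by rewrite -b1_g b1_dim_lcs2 subnK ?dimvS ?subvf.
rewrite b1_g in tdim adim; split; first lia.
rewrite binS bin1 [in X in _ - _ - X]dimD; lia.
Qed.
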